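(* Let $(X,\|\cdot\|)$ be a normed vector space over $\mathbb{R}$ of dimension $d<\infty$, let $\mu$ be a Radon measure on $X$, let $\Omega$ be a measurable subset of $X$, and let $f$ be an arbitrary measurable, real-valued function on $\Omega$. Then $f$ is integrable if the following condition holds for some $\lambda\ge1$ and some $\mu$-a.e., $\lambda$-Morse cover $\mathcal{S}$ of $\Omega$: There is a number $M\ge0$ and a gauge function $\delta:\Omega\to(0,1]$ such that for any finite or countably infinite disjoint sequence $\langle S_n(x_n)\rangle$ of $\delta$-fine sets from $\mathcal{S}$ (with tags $x_n$) covering all but a set of $\mu$-measure $0$ of $\Omega$ we have $$\sum_n|f(x_n)|\,\mu(S_n)\le M.$$ Conversely, if $f$ is integrable, then the condition holds for all $\lambda\ge1$ and all $\mu$-a.e., $\lambda$-Morse covers $\mathcal{S}$ of $\Omega$. In this case, for each such $\lambda$-Morse cover $\mathcal{S}$ and each $\varepsilon>0$, there is a gauge function $\delta:\Omega\to(0,1]$ so that for any finite or countably infinite disjoint sequence $\langle S_n(x_n)\rangle$ of $\delta$-fine sets from $\mathcal{S}$ covering all but a set of $\mu$-measure $0$ of $\Omega$ we have $$\Bigl|\sum_n f(x_n)\,\mu(S_n)-\int_\Omega f\,d\mu\Bigr|<\varepsilon.$$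
   Context: $B(a,r)=\{x\in X:\|x-a\|\le r\}$ is the closed ball. $f$ is integrable if both $f^+=\max(f,0)$ and $f^-=\max(-f,0)$ have finite integrals over $\Omega$ with respect to $\mu$. Radon measure: a measure $\mu$ on a $\sigma$-algebra $\mathcal{M}$ of subsets of $X$ such that $\mathcal{M}$ contains the Borel sets, compact sets have finite measure, and every $E\in\mathcal{M}$ satisfies $\mu(E)=\sup\{\mu(K):K\subseteq E,\ K\text{ compact}\}=\inf\{\mu(G):G\supseteq E,\ G\text{ open}\}$. ''Measurable'' (or $\mu$-measurable) means measurable with respect to the $\mu$-completion of $\mathcal{M}$. Morse sets: for $\lambda\ge1$ and $a\in X$, a set $S=S_\lambda(a)\subseteq X$ is a $\lambda$-Morse set associated with $a$ if there is $r>0$ such that $B(a,r)\subseteq S\subseteq B(a,\lambda r)$ and $S$ is starlike with respect to $B(a,r)$, i.e. for each $y\in B(a,r)$ and $x\in S$ the segment $\{\alpha y+(1-\alpha)x:0\le\alpha\le1\}$ is contained in $S$. The point $a$ is the tag of $S$. A gauge function is a strictly positive function $\delta$ bounded above by some finite $R$ (defined on $X$, or on the set of tags). $S_\lambda(a)$ is $\delta$-fine if $\lambda r\le\delta(a)$. Morse covers: a $\lambda$-Morse cover of $\Omega$ is a collection $\mathcal{S}$ consisting of at least one $\lambda$-Morse set associated with each point $a\in\Omega$ (the same $\lambda$ for all sets; tags are points of $\Omega$) such that the diameters of the sets in $\mathcal{S}$ have a finite upper bound. It is fine if for each $a\in\Omega$ and arbitrarily small values of $r>0$ there are associated sets $S_\lambda(a)\in\mathcal{S}$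 with $B(a,r)\subseteq S_\lambda(a)\subseteq B(a,\lambda r)$ and $S_\lambda(a)$ starlike with respect to $B(a,r)$. It is a $\mu$-a.e. cover of $\Omega$ if (i) it is fine, (ii) each set in it is $\mu$-measurable, and (iii) for any $\varepsilon>0$ and any strictly positive gauge function $\delta$ there is a finite or infinite sequence of disjoint, $\delta$-fine sets $S_n\in\mathcal{S}$ such that $\mu(\Omega\setminus\bigcup_nS_n)=0$ and $\mu(\bigcup_nS_n\setminus\Omega)<\varepsilon$. *)

(* Defs.v *)
From HB Require Import structures.
From mathcomp Require Import all_boot all_order all_algebra.
From mathcomp Require Import all_classical all_reals all_analysis.
From mathcomp Require Import measurable_realfun.

Set Implicit Arguments.
Unset Strict Implicit.
Unset Printing Implicit Defensive.

Import Order.TTheory GRing.Theory Num.Theory.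
Import numFieldNormedType.Exports.

Local Open Scope classical_set_scope.
Local Open Scope ring_scope.

Section completion.
Context d (T : measurableType d) (R : realType).
Variable mu : {measure set T -> \bar R}.

Definition completionType := g_sigma_algebraType (completed_algebra_gen mu).
HB.instance Definition _ := Measurable.on completionType.

Let kernel_spec (E A : set T) :=
  [/\ measurable A, A `<=` E & mu.-negligible (E `\` A)].

(* The value at [A `|` N], with [A] measurable and [N] negligible, is [mu A]
   (lemma [completionE]); the value outside of the completed sigma-algebra is
   the junk value [mu set0]. *)
Definition completion (E : set completionType) : \bar R :=
  mu (xget set0 [set A | kernel_spec E A]).

Let kernelP (A N : set T) : measurable A -> mu.-negligible N ->
  kernel_spec (A `|` N) A.
Proof.
move=> mA nN; split => //.
by apply: (negligibleS _ nN) => x [[Ax|//] nAx]; case: nAx.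
Qed.

Let kernel_uniq (E A B : set T) : kernel_spec E A -> kernel_spec E B ->
  mu A = mu B.
Proof.
suff h C D : kernel_spec E C -> kernel_spec E D -> (mu C <= mu D)%E.
  by move=> EA EB; apply/eqP; rewrite eq_le !h.
move=> [mC CE nC] [mD DE nD].
have nCD : mu.-negligible (C `\` D).
  by apply: (negligibleS _ nD) => x [Cx Dx]; split => //; exact: CE.
rewrite (measureDI mu mC mD) (measure_negligible _ nCD) ?add0e; last first.
  exact: measurableD.
by apply: le_measure; rewrite ?inE//; exact: measurableI.
Qed.

Lemma completionE (A N : set T) : measurable A -> mu.-negligible N ->
  completion (A `|` N) = mu A.
Proof.
move=> mA nN; have AN := kernelP mA nN; rewrite /completion.
by case: xgetP => [B -> BE|/(_ A) //]; exact: kernel_uniq BE AN.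
Qed.

Lemma completed_algebra_gen_sigma_algebra :
  sigma_algebra setT (completed_algebra_gen mu).
Proof.
split.
- by exists set0 => //; exists set0; rewrite ?setU0//; exact: negligible_set0.
- move=> _ [A mA [N [B [mB B0 NB]] <-]].
  exists (~` A `\` B); first exact: measurableD (measurableC mA) mB.
  exists (~` A `&` (B `\` N)).
    by exists B; split => // x [_ []].
  rewrite setTD; apply/seteqP; split => [x|x /= ANx].
    by move=> [[Ax Bx]|[Ax [Bx Nx]]] [//|//] /NB.
  have Ax : ~ A x by move=> ?; apply: ANx; left.
  have Nx : ~ N x by move=> ?; apply: ANx; right.
  by case: (pselect (B x)) => Bx; [right|left].
- move=> F cF.
  have {}cF n : exists AN : set T * set T,
      [/\ measurable AN.1, mu.-negligible AN.2 & AN.1 `|` AN.2 = F n].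
    by have [A mA [N nN <-]] := cF n; exists (A, N).
  have [G GP] := choice cF.
  exists (\bigcup_n (G n).1).
    by apply: bigcupT_measurable => n; have [] := GP n.
  exists (\bigcup_n (G n).2).
    by apply: negligible_bigcup => n; have [] := GP n.
  by rewrite -bigcupU; apply: eq_bigcupr => n _; have [] := GP n.
Qed.

Lemma measurable_completionE :
  (measurable : set (set completionType)) = completed_algebra_gen mu.
Proof.
exact: (measurable_g_measurableTypeE completed_algebra_gen_sigma_algebra).
Qed.

Let completion0 : completion set0 = 0%E.
Proof.
by rewrite -(setU0 set0) completionE ?measure0//; exact: negligible_set0.
Qed.

Let completion_ge0 E : (0 <= completion E)%E.
Proof. exact: measure_ge0. Qed.

Let completion_semi_sigma_additive : semi_sigma_additive completion.
Proof.
move=> F mF tF _.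
have {}mF n : exists AN : set T * set T,
    [/\ measurable AN.1, mu.-negligible AN.2 & AN.1 `|` AN.2 = F n].
  have := mF n; rewrite measurable_completionE => -[A mA [N nN <-]].
  by exists (A, N).
have [G GP] := choice mF.
have FE n : completion (F n) = mu (G n).1.
  by have [mA nN <-] := GP n; rewrite completionE.
have -> : completion (\bigcup_n F n) = mu (\bigcup_n (G n).1).
  rewrite -(@completionE _ (\bigcup_n (G n).2)).
  - congr completion.
    by rewrite -bigcupU; apply: eq_bigcupr => n _; have [] := GP n.
  - by apply: bigcupT_measurable => n; have [] := GP n.
  - by apply: negligible_bigcup => n; have [] := GP n.
under eq_fun do under eq_bigr do rewrite FE.
apply: measure_semi_sigma_additive => [n| |].
- by have [] := GP n.
- move=> i j _ _ [x [Gi Gj]]; apply: tF => //; exists x.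
  by have [_ _ <-] := GP i; have [_ _ <-] := GP j; split; left.
- by apply: bigcupT_measurable => n; have [] := GP n.
Qed.

HB.instance Definition _ := isMeasure.Build _ _ _ completion
  completion0 completion_ge0 completion_semi_sigma_additive.

End completion.
Arguments completion {d T R} mu E.

Section radon.
Context (R : realType) (X : normedModType R).
Local Open Scope ereal_scope.

(* [mu] lives on [g_sigma_algebraType M], whose measurable sets [<<s M>>] are
   exactly the elements of [M] since [M] is required to be a sigma-algebra. *)
Definition radon_measure (M : set (set X))
    (mu : {measure set (g_sigma_algebraType M) -> \bar R}) : Prop :=
  [/\ sigma_algebra setT M,
      <<s [set U : set X | open U] >> `<=` M,
      forall K : set X, compact K -> mu K < +oo,
      forall E, M E ->
        mu E = ereal_sup [set mu K | K in [set K : set X | compact K /\ K `<=` E]]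
    & forall E, M E ->
        mu E = ereal_inf [set mu G | G in [set G : set X | open G /\ E `<=` G]]].

End radon.

Section morse.
Context (R : realType) (X : normedModType R).
Implicit Types (lambda r : R) (a : X) (S Omega : set X) (delta : X -> R).

Definition diameter S : \bar R :=
  ereal_sup [set (`|x - y|)%:E | x in S & y in S].

Definition starlike S (B : set X) : Prop :=
  forall y x, B y -> S x ->
  forall alpha : R, 0 <= alpha <= 1 -> S (alpha *: y + (1 - alpha) *: x).

Definition morse_radius lambda a S r : Prop :=
  [/\ 0 < r, closed_ball_ Num.norm a r `<=` S,
      S `<=` closed_ball_ Num.norm a (lambda * r)
    & starlike S (closed_ball_ Num.norm a r)].

Definition morse_set lambda a S : Prop := exists r, morse_radius lambda a S r.

(* Gauges are total functions of which only the values on the set of tags [D]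
   matter. *)
Definition gauge (D : set X) delta : Prop :=
  (forall a, D a -> 0 < delta a) /\
  (exists C : R, forall a, D a -> delta a <= C).

Definition unit_gauge (D : set X) delta : Prop :=
  forall a, D a -> 0 < delta a <= 1.

(* The radius is not part of the data of a tagged set: fineness asks for some
   radius witnessing the Morse property. *)
Definition delta_fine lambda delta a S : Prop :=
  exists r, morse_radius lambda a S r /\ lambda * r <= delta a.

(* A collection of tagged sets is a set of pairs (tag, set). *)
Definition morse_cover lambda Omega (C : set (X * set X)) : Prop :=
  [/\ forall a S, C (a, S) -> Omega a /\ morse_set lambda a S,
      forall a, Omega a -> exists S, C (a, S)
    & exists D : R, forall a S, C (a, S) -> (diameter S <= D%:E)%E].

Definition fine_cover lambda Omega (C : set (X * set X)) : Prop :=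
  forall a, Omega a -> forall eta : R, 0 < eta ->
  exists r S, [/\ r < eta, C (a, S) & morse_radius lambda a S r].

(* Index sets of finite (possibly empty) and of infinite sequences. *)
Definition sequence_index (I : set nat) : Prop :=
  I = setT \/ exists n, I = `I_n.

Context (M : set (set X)).
Variable mu : {measure set (g_sigma_algebraType M) -> \bar R}.

Definition fine_packing lambda Omega (C : set (X * set X)) delta
    (I : set nat) (x : nat -> X) (S : nat -> set X) : Prop :=
  [/\ sequence_index I,
      trivIset I S,
      forall n, I n -> C (x n, S n) /\ delta_fine lambda delta (x n) (S n)
    & completion mu (Omega `\` \bigcup_(n in I) S n) = 0%E].

Definition ae_morse_cover lambda Omega (C : set (X * set X)) : Prop :=
  [/\ morse_cover lambda Omega C,
      fine_cover lambda Omega C,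
      forall a S, C (a, S) -> measurable (S : set (completionType mu))
    & forall (eps : R) delta, 0 < eps -> gauge Omega delta ->
      exists (I : set nat) (x : nat -> X) (S : nat -> set X),
        fine_packing lambda Omega C delta I x S /\
        (completion mu ((\bigcup_(n in I) S n) `\` Omega) < eps%:E)%E].

Definition bounded_sums lambda Omega (C : set (X * set X)) (f : X -> R) :
    Prop :=
  exists (B : R) delta, [/\ 0 <= B, unit_gauge Omega delta
    & forall (I : set nat) (x : nat -> X) (S : nat -> set X),
        fine_packing lambda Omega C delta I x S ->
      (\sum_(0 <= n <oo | n \in I)
         (`|f (x n)|%:E * completion mu (S n)) <= B%:E)%E].

(* For a finite index set the series is eventually constant. The sets of a
   packing are bounded, hence of finite measure. *)
Definition riemann_series (f : X -> R) (I : set nat) (x : nat -> X)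
    (S : nat -> set X) : R^nat :=
  [series if n \in I then f (x n) * fine (completion mu (S n)) else 0]_n.

End morse.

(* Main.v *)
(* Integrability is a McShane property of regular measures. If [f] is
   integrable, then for every [e > 0] there is a gauge [delta] such that all
   disjoint measurable sets [S n] contained in balls of centre [x n] and radius
   [delta (x n)] satisfy [\sum_n \int_(S n) |f (x n) - f| <= e]. This is
   immediate for the indicator of a compact set [K], by outer regularity, it is
   stable under linear combinations, and it is stable under limits in L^1,
   because
   [\sum_n g (x n) * mu (S n)] is, for a suitable gauge, at most
   [2 * \int g + e] for every nonnegative integrable [g]. As the sets of a
   packing cover almost all of [Omega], the Riemann sums of [f], extended by [0]
   outside of [Omega], are then close to the integral. Conversely, bounded sums
   for [f] bound the integral of [|f|] over every set on which [f] is
   integrable, and inner regularity provides enough such sets. *)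
Require Import Defs.
From HB Require Import structures.
From mathcomp Require Import all_boot all_order all_algebra.
From mathcomp Require Import all_classical all_reals all_analysis.
From mathcomp Require Import measurable_realfun ring lra.
Import Order.TTheory GRing.Theory Num.Theory.
Import numFieldNormedType.Exports.
Local Open Scope classical_set_scope.
Local Open Scope ring_scope.

Set Implicit Arguments.
Unset Strict Implicit.
Unset Printing Implicit Defensive.

(** * The McShane criterion *)

Section mcshane.
Import HBSimple.
Context d (T : measurableType d) (R : realType).
Variables (mu : {measure set T -> \bar R}) (Bl : T -> R -> set T).

(* The topology enters only through the balls [Bl x r]. *)
Definition nbhd_of (A G : set T) :=
  forall x, A x -> exists2 r : R, 0 < r & Bl x r `<=` G.

(** All of [nat] serves as index set; a finite family is continued by empty sets, on which the last
    clause is vacuous. *)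
Definition packing (delta : T -> R) (x : nat -> T) (S : nat -> set T) :=
  [/\ forall n, measurable (S n), trivIset setT S
    & forall n, S n `<=` Bl (x n) (delta (x n))].

(** The absolute value stands inside the integrals, so no cancellation occurs and the deviation is
    subadditive in [f]. *)
Definition mcshane_integrable (f : T -> R) := forall e : R, 0 < e ->
  exists2 delta : T -> R, (forall x, 0 < delta x) &
    forall x S, packing delta x S ->
    (\sum_(0 <= n <oo) \int[mu]_(y in S n) `|f (x n) - f y|%:E <= e%:E)%E.

Hypothesis Bl_mono : forall x (r s : R), r <= s -> Bl x r `<=` Bl x s.

Hypothesis outer_regular : forall A (e : R),
  measurable A -> (mu A < +oo)%E -> 0 < e ->
  exists G, [/\ measurable G, A `<=` G, (mu G <= mu A + e%:E)%E & nbhd_of A G].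

Hypothesis inner_regular : forall A (e : R),
  measurable A -> (mu A < +oo)%E -> 0 < e ->
  exists K, [/\ measurable K, K `<=` A, (mu A <= mu K + e%:E)%E
              & nbhd_of (~` K) (~` K)].

Lemma packingW (delta1 delta2 : T -> R) x S :
  (forall t, delta1 t <= delta2 t) -> packing delta1 x S -> packing delta2 x S.
Proof.
move=> le12 [mS tS xS]; split=> // n; apply: subset_trans (xS n) _.
exact: Bl_mono.
Qed.

Lemma nneseries_integral_packing delta x S (g : T -> \bar R) :
  packing delta x S -> measurable_fun setT g -> (forall t, 0 <= g t)%E ->
  (\sum_(0 <= n <oo) \int[mu]_(y in S n) g y <= \int[mu]_y g y)%E.
Proof.
move=> [mS tS _] mg g0; rewrite -ge0_integral_bigcup//.
- by apply: ge0_subset_integral => //; exact: bigcupT_measurable.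
- exact: measurable_funTS.
Qed.

Lemma exists_gauge (P : T -> R -> Prop) :
  (forall t, exists2 r : R, 0 < r & P t r) ->
  exists2 delta : T -> R, (forall t, 0 < delta t) & forall t, P t (delta t).
Proof.
move=> h; have /choice[delta hd] : forall t, exists r, 0 < r /\ P t r.
  by move=> t; have [r ? ?] := h t; exists r.
by exists delta => t; have [] := hd t.
Qed.

(** The last hypothesis says that [K] is closed. Balls around tags in [K] stay in an outer
    approximation [G], and balls around other tags miss [K]; either way the deviation is nonzero
    only on the part of [G] outside [K], whose measure is at most [e]. *)
Lemma mcshane_indic K : measurable K -> (mu K < +oo)%E ->
  nbhd_of (~` K) (~` K) -> mcshane_integrable \1_K.
Proof.
move=> mK Koo oK e e0; have [G [mG KG GK oG]] := outer_regular mK Koo e0.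
have [|delta delta0 hd] := @exists_gauge
    (fun t r => (K t -> Bl t r `<=` G) /\ (~ K t -> Bl t r `<=` ~` K)).
  move=> t; have [Kt|nKt] := pselect (K t).
    by have [r r0 rG] := oG t Kt; exists r.
  by have [r r0 rG] := oK t nKt; exists r.
exists delta => // x S pS; have [mS tS xS] := pS.
apply: (@le_trans _ _ (\sum_(0 <= n <oo)
    \int[mu]_(y in S n) (\1_(G `\` K) y)%:E)%E).
  apply: lee_nneseries => [n _ _|n _].
    by apply: integral_ge0 => y _; rewrite lee_fin.
  apply: ge0_le_integral => //.
  - apply/measurable_EFinP; apply: measurableT_comp => //.
    by apply: measurable_funB => //; exact: measurable_indic.
  - by apply/measurable_EFinP; apply: measurable_indic; exact: measurableD.
  - move=> y Sy; rewrite lee_fin; have [h1 h2] := hd (x n).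
    have {}xS := xS n y Sy; rewrite !indicE.
    have [Kx|nKx] := pselect (K (x n)).
      rewrite (mem_set Kx); have Gy := h1 Kx _ xS.
      have [Ky|nKy] := pselect (K y).
        by rewrite (mem_set Ky) subrr normr0.
      by rewrite (memNset nKy) subr0 normr1 mem_set.
    rewrite (memNset nKx) (memNset (h2 nKx _ xS)) subrr normr0.
    by rewrite ler0n.
apply: le_trans (nneseries_integral_packing pS _ _) _.
- by apply/measurable_EFinP; apply: measurable_indic; exact: measurableD.
- by move=> y; rewrite lee_fin.
rewrite integral_indic//; last exact: measurableD.
rewrite setIT measureD// ?(setIidr KG); last first.
  by apply: le_lt_trans GK _; rewrite lte_add_pinfty// ltry.
by rewrite leeBlDr ?ge0_fin_numE// addeC.
Qed.

Lemma dyadic_cover : exists c : nat -> R, (forall k, 0 < c k) /\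
  forall t, 0 < t -> exists k, c k <= t <= 2 * c k.
Proof.
(* The scales are the positive rationals, listed through [pickle]; 1 is a filler for numbers that
   code no pair. *)
pose c k : R := if (unpickle k : option (nat * nat)) is Some (a, b)
  then a.+1%:R / b.+1%:R else 1.
exists c; split=> [k|t t0].
  by rewrite /c; case: unpickle => [[a b]|]//; rewrite divr_gt0.
(* This [b] gives [1 < t * b.+1], so the integer part [a] of the product is at least 1 and
   [a <= t * b.+1 < a + 1 <= 2 * a]. *)
pose b := Num.truncn t^-1.
have tb : t^-1 < b.+1%:R by rewrite truncnS_gt.
have tb1 : 1 < t * b.+1%:R by rewrite -ltr_pdivrMl// mulr1.
have := truncn_itv (ltW (lt_trans ltr01 tb1)).
set a := Num.truncn _ => /andP[at1 at2].
have a0 : (0 < a)%N by rewrite truncn_gt0 ltW.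
exists (pickle (a.-1, b)); rewrite /c pickleK prednK//.
rewrite ler_pdivrMr// at1 mulrA ler_pdivlMr//=.
apply/ltW/(lt_le_trans at2); rewrite -natr1.
have : 1 <= a%:R :> R by rewrite ler1n.
lra.
Qed.

(* A tag [x] at level [c k <= g x <= 2 * c k] forces its set into an outer
   approximation [G k] of that level, hence [g x <= H] on this set, where
   [H := \sum_k 2 * c k * \1_(G k)] has integral at most [2 * \int g + e]. *)
Lemma mcshane_bound (g : T -> R) (e : R) : measurable_fun setT g ->
  (forall t, 0 <= g t) -> (\int[mu]_t (g t)%:E < +oo)%E -> 0 < e ->
  exists2 delta : T -> R, (forall t, 0 < delta t) &
    forall x S, packing delta x S ->
    (\sum_(0 <= n <oo) (g (x n))%:E * mu (S n) <=
      2%:E * \int[mu]_t (g t)%:E + e%:E)%E.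
Proof.
move=> mg g0 goo e0.
have [c [c0 hc]] := dyadic_cover.
pose F k := g @^-1` `[c k, 2 * c k]%classic.
have mF k : measurable (F k) by rewrite -[F k]setTI; apply: mg.
(* Once the levels are disjoint, Markov's inequality on each of them sums to a bound by the integral
   of [g]. *)
pose A := seqDU F.
have mA k : measurable (A k).
  by apply: measurableD => //; exact: bigsetU_measurable.
have AF k : A k `<=` F k by move=> ? [].
have covA t : 0 < g t -> exists k, A k t.
  move=> /hc[k hk]; have : (\bigcup_k A k) t.
    by rewrite -seqDU_bigcup_eq; exists k => //=; rewrite in_itv.
  by move=> [j _ Aj]; exists j.
have cA k : ((c k)%:E * mu (A k) <= \int[mu]_(y in A k) (g y)%:E)%E.
  rewrite -integral_cst//; apply: ge0_le_integral => //.
  - by move=> y _; rewrite lee_fin ltW.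
  - by apply/measurable_EFinP/measurable_funTS.
  - by move=> y /AF; rewrite /F/= in_itv/= lee_fin => /andP[].
have sumA : (\sum_(k <oo) \int[mu]_(y in A k) (g y)%:E <=
    \int[mu]_y (g y)%:E)%E.
  rewrite -ge0_integral_bigcup//.
  - apply: ge0_subset_integral => //; first exact: bigcupT_measurable.
    + by apply/measurable_EFinP.
    + by move=> y _; rewrite lee_fin.
  - by apply/measurable_EFinP/measurable_funTS.
  - by move=> y _; rewrite lee_fin.
  - exact: trivIset_seqDU.
have Aoo k : (mu (A k) < +oo)%E.
  have h : ((c k)%:E * mu (A k) < +oo)%E.
    apply: le_lt_trans (cA k) (le_lt_trans _ goo).
    apply: ge0_subset_integral => //; first by apply/measurable_EFinP.
    by move=> y _; rewrite lee_fin.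
  move: h; apply: contraTT; rewrite -!leNgt !leye_eq => /eqP ->.
  by rewrite gt0_muley// lte_fin.
(* The measure of [G k] enters the integral of [H] with weight [2 * c k], so the error made at level
   [k] costs [e / 2 ^ k.+1]. *)
pose ek k : R := e / (2 ^ k.+1)%:R / (2 * c k).
have ek0 k : 0 < ek k.
  by rewrite /ek !divr_gt0// ?mulr_gt0// ?ltr0n ?expn_gt0.
have /choice[G hG] k := outer_regular (mA k) (Aoo k) (ek0 k).
have [|delta delta0 hd] := @exists_gauge
    (fun t r => 0 < g t -> exists2 k, A k t & Bl t r `<=` G k).
  move=> t; have [gt0|gt0] := ltP 0 (g t); last by exists 1.
  have [k Ak] := covA t gt0; have [_ _ _ /(_ t Ak)[r r0 rG]] := hG k.
  by exists r => // _; exists k.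
exists delta => // x S pS; have [mS tS xS] := pS.
pose H y : \bar R := (\sum_(k <oo) (2 * c k)%:E * (\1_(G k) y)%:E)%E.
have mG k : measurable (G k) by have [] := hG k.
have H0 k y : (0 <= (2 * c k)%:E * (\1_(G k) y)%:E)%E.
  by rewrite mule_ge0 ?lee_fin// mulr_ge0// ltW.
have mH : measurable_fun setT H.
  apply: ge0_emeasurable_sum => [k t _ _|k _]; first exact: H0.
  by apply: measurable_funeM; apply/measurable_EFinP; exact: measurable_indic.
have Hge0 y : (0 <= H y)%E by apply: nneseries_ge0.
apply: (@le_trans _ _ (\sum_(0 <= n <oo) \int[mu]_(y in S n) H y)%E).
  apply: lee_nneseries => [n _ _|n _]; first by rewrite mule_ge0 ?lee_fin.
  rewrite -integral_cst//; apply: ge0_le_integral => //=.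
  - by move=> y _; rewrite lee_fin.
  - exact: measurable_funTS.
  - move=> y Sy; have := g0 (x n); rewrite le_eqVlt => /predU1P[<-|gx0]//.
    have [k Ak BG] := hd (x n) gx0.
    apply: (@le_trans _ _ ((2 * c k)%:E * (\1_(G k) y)%:E)%E).
      rewrite indicE mem_set; last by apply: BG; exact: (xS n).
      rewrite mule1 lee_fin; have := AF _ _ Ak.
      by rewrite /F/= in_itv/= => /andP[].
    rewrite /H (@nneseriesD1 _ _ k)//= leeDl// nneseries_ge0//.
apply: le_trans (nneseries_integral_packing pS mH Hge0) _.
rewrite integral_nneseries//; last first.
  move=> k.
  by apply: measurable_funeM; apply/measurable_EFinP; exact: measurable_indic.
apply: (@le_trans _ _ (\sum_(k <oo)
    (2%:E * \int[mu]_(y in A k) (g y)%:E + (e / (2 ^ k.+1)%:R)%:E))%E).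
  apply: lee_nneseries => [k _ _|k _]; first by apply: integral_ge0.
  rewrite ge0_integralZl//; first last.
  - by rewrite lee_fin mulr_ge0// ltW.
  - by apply/measurable_EFinP; exact: measurable_indic.
  rewrite integral_indic// setIT; have [_ _ GA _] := hG k.
  apply: (@le_trans _ _ ((2 * c k)%:E * (mu (A k) + (ek k)%:E))%E).
    by rewrite lee_pmul2l// lte_fin mulr_gt0.
  rewrite ge0_muleDr//; last by rewrite lee_fin ltW.
  apply: leeD.
    by rewrite EFinM -muleA lee_pmul2l.
  rewrite lee_fin /ek mulrC divfK// mulf_neq0// gt_eqF//.
apply: le_trans (epsilon_trick _ _ _) _ => //; last 1 first.
- rewrite leeD2r// nneseriesZl; last first.
    by move=> k _; apply: integral_ge0 => y _; rewrite lee_fin.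
  by rewrite lee_pmul2l.
- by move=> k; rewrite mule_ge0// integral_ge0// => y _; rewrite lee_fin.
- exact: ltW.
Qed.

Lemma packing_min (delta1 delta2 : T -> R) x S :
  packing (fun t => Order.min (delta1 t) (delta2 t)) x S ->
  packing delta1 x S /\ packing delta2 x S.
Proof.
by move=> pS; split; apply: packingW pS => // t; rewrite ge_min lexx ?orbT.
Qed.

(** The integrands depend on the index because they contain values at the tag [x n]. *)
Lemma nneseries_integralD (S : nat -> set T) (u v w : nat -> T -> R) :
  (forall n, measurable (S n)) ->
  (forall n, measurable_fun setT (u n)) ->
  (forall n, measurable_fun setT (v n)) ->
  (forall n, measurable_fun setT (w n)) ->
  (forall n y, 0 <= u n y) -> (forall n y, 0 <= v n y) ->
  (forall n y, 0 <= w n y) ->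
  (forall n y, S n y -> u n y <= v n y + w n y) ->
  (\sum_(0 <= n <oo) \int[mu]_(y in S n) (u n y)%:E <=
   \sum_(0 <= n <oo) \int[mu]_(y in S n) (v n y)%:E +
   \sum_(0 <= n <oo) \int[mu]_(y in S n) (w n y)%:E)%E.
Proof.
move=> mS mu_ mv mw u0 v0 w0 uvw.
rewrite -nneseriesD;
  [|by move=> n _ _; apply: integral_ge0 => y _; rewrite lee_fin..].
apply: lee_nneseries => [n _ _|n _].
  by apply: integral_ge0 => y _; rewrite lee_fin.
rewrite -ge0_integralD//; first last.
- by apply/measurable_EFinP/measurable_funTS.
- by move=> y _; rewrite lee_fin.
- by apply/measurable_EFinP/measurable_funTS.
- by move=> y _; rewrite lee_fin.
apply: ge0_le_integral => //.
- by move=> y _; rewrite lee_fin.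
- by apply/measurable_EFinP/measurable_funTS.
- by apply/measurable_EFinP/measurable_funTS/measurable_funD.
- by move=> y Sy; rewrite lee_fin; exact: uvw.
Qed.

Let measurable_dev (f : T -> R) (c : R) : measurable_fun setT f ->
  measurable_fun setT (fun y => `|c - f y|).
Proof.
by move=> mf; apply: measurableT_comp => //; exact: measurable_funB.
Qed.

Lemma mcshaneD (f g : T -> R) :
  measurable_fun setT f -> measurable_fun setT g ->
  mcshane_integrable f -> mcshane_integrable g ->
  mcshane_integrable (fun t => f t + g t).
Proof.
move=> mf mg If Ig e e0; have e20 : 0 < e / 2 by rewrite divr_gt0.
have [df df0 hf] := If _ e20; have [dg dg0 hg] := Ig _ e20.
exists (fun t => Order.min (df t) (dg t)).
  by move=> t; rewrite lt_min df0 dg0.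
move=> x S pS; have [pf pg] := packing_min pS; have [mS _ _] := pS.
apply: le_trans (nneseries_integralD mS _ (fun n => measurable_dev (f (x n)) mf)
  (fun n => measurable_dev (g (x n)) mg) _ _ _ _) _ => //.
- by move=> n; apply: measurable_dev; exact: measurable_funD.
- by move=> n y Sy; rewrite opprD addrACA ler_normD.
- rewrite [e]splitr EFinD; apply: leeD; [exact: hf|exact: hg].
Qed.

Lemma mcshaneZ (f : T -> R) a : measurable_fun setT f ->
  mcshane_integrable f -> mcshane_integrable (fun t => a * f t).
Proof.
(* Adding 1 keeps the divisor positive when [a] is 0. *)
move=> mf If e e0; have a0 : 0 < `|a| + 1 by rewrite ltr_wpDl.
have [df df0 hf] := If _ (divr_gt0 e0 a0); exists df => // x S pS.
have [mS _ _] := pS.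
apply: (@le_trans _ _ (\sum_(0 <= n <oo) (`|a| + 1)%:E *
    \int[mu]_(y in S n) `|f (x n) - f y|%:E)%E).
  apply: lee_nneseries => [n _ _|n _].
    by apply: integral_ge0 => y _; rewrite lee_fin.
  rewrite -ge0_integralZl//.
  - apply: ge0_le_integral => //.
    + apply/measurable_EFinP/measurable_funTS/measurable_dev.
      exact: measurable_funM.
    + apply: measurable_funeM.
      by apply/measurable_EFinP/measurable_funTS/measurable_dev.
    + move=> y _; rewrite -EFinM lee_fin -mulrBr normrM ler_wpM2r//.
      by rewrite lerDl.
  - by apply/measurable_EFinP/measurable_funTS/measurable_dev.
rewrite nneseriesZl; last first.
  by move=> n _; apply: integral_ge0 => y _; rewrite lee_fin.
apply: (@le_trans _ _ ((`|a| + 1)%:E * (e / (`|a| + 1))%:E)%E).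
  by rewrite lee_pmul2l// hf.
by rewrite -EFinM lee_fin mulrC divfK// gt_eqF.
Qed.

(** The triangle inequality passes through [h] both at the tag and at the point. Closeness in L^1
    does not control [|f - h|] at individual tags, but [mcshane_bound] controls the sum of these
    values weighted by the measures of the sets. *)
Lemma mcshane_closed (f : T -> R) : measurable_fun setT f ->
  (forall e : R, 0 < e -> exists h : T -> R, [/\ measurable_fun setT h,
    mcshane_integrable h & (\int[mu]_y `|f y - h y|%:E <= e%:E)%E]) ->
  mcshane_integrable f.
Proof.
(* Three fifths go to [mcshane_bound], as [2 * (e / 5) + e / 5], one to the deviation of [h] and one
   to the integral of [|f - h|]. *)
move=> mf cl e e0; have e50 : 0 < e / 5 by rewrite divr_gt0.
have [h [mh Ih fh]] := cl _ e50; have [dh dh0 hh] := Ih _ e50.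
have mfh : measurable_fun setT (fun y => `|f y - h y|).
  by apply: measurableT_comp => //; exact: measurable_funB.
have [dg dg0 hg] := mcshane_bound mfh (fun=> normr_ge0 _)
  (le_lt_trans fh (ltry _)) e50.
exists (fun t => Order.min (dh t) (dg t)).
  by move=> t; rewrite lt_min dh0 dg0.
move=> x S pS; have [ph pg] := packing_min pS; have [mS _ _] := pS.
have mhD n : measurable_fun setT (fun y => `|h (x n) - h y| + `|f y - h y|).
  by apply: measurable_funD => //; exact: measurable_dev.
apply: le_trans (nneseries_integralD (v := fun n _ => `|f (x n) - h (x n)|)
  mS _ _ mhD _ _ _ _) _ => //.
- by move=> n; exact: measurable_dev.
- move=> n y _; rewrite [X in _ <= X]addrA.
  have -> : f (x n) - f y = (f (x n) - h (x n)) + (h (x n) - h y) - (f y - h y).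
    by ring.
  by apply: le_trans (ler_normB _ _) _; rewrite lerD2r ler_normD.
have -> : e = (2 * (e / 5) + e / 5) + (e / 5 + e / 5) by lra.
rewrite EFinD; apply: leeD.
  under eq_eseriesr do rewrite integral_cst//.
  apply: le_trans (hg _ _ pg) _.
  by rewrite [X in (_ <= X)%E]EFinD leeD2r// EFinM lee_pmul2l ?lte_fin.
apply: le_trans (nneseries_integralD (w := fun=> fun y => `|f y - h y|) mS mhD
  (fun n => measurable_dev (h (x n)) mh) (fun=> mfh) _ _ _ _) _ => //.
rewrite EFinD; apply: leeD; first exact: hh.
apply: le_trans (nneseries_integral_packing pS _ _) fh => //.
exact/measurable_EFinP.
Qed.

(** By inner regularity, the indicator of [A] is an L^1 limit of indicators of closed sets. *)
Lemma mcshane_indic_measurable A : measurable A -> (mu A < +oo)%E ->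
  mcshane_integrable \1_A.
Proof.
move=> mA Aoo; apply: mcshane_closed => [|e e0]; first exact: measurable_indic.
have [K [mK KA AK oK]] := inner_regular mA Aoo e0.
have Koo : (mu K < +oo)%E by apply: le_lt_trans Aoo; rewrite le_measure ?inE.
exists \1_K; split; first exact: measurable_indic.
  exact: mcshane_indic.
under eq_integral => y _.
  have -> : `|\1_A y - \1_K y| = \1_(A `\` K) y :> R.
    rewrite !indicE; have [Ky|nKy] := pselect (K y).
      rewrite (mem_set Ky) (mem_set (KA _ Ky)) subrr normr0 memNset//.
      by move=> [].
    rewrite (memNset nKy) subr0 ger0_norm//.
    have [Ay|nAy] := pselect (A y); first by rewrite !mem_set.
    by rewrite !memNset// => -[].
  over.
rewrite integral_indic//; last exact: measurableD.
rewrite setIT measureD// (setIidr KA).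
by rewrite leeBlDr ?ge0_fin_numE// addeC.
Qed.

Lemma mcshane_sfun (f : {sfun T >-> R}) : mu.-integrable setT (EFin \o f) ->
  mcshane_integrable f.
Proof.
move=> /integrableP[_ foo].
have mf : measurable_fun setT f by [].
have [s ->] : exists s : seq R, (f : T -> R) =
    (fun t => \sum_(y <- s) y * \1_(f @^-1` [set y]) t).
  exists (finmap.enum_fset (fset_set (range f))).
  by apply/funext => t; rewrite fimfunE fsbig_finite.
have mpre y : measurable (f @^-1` [set y]).
  by rewrite -[X in measurable X]setTI; exact: mf.
have mterm y : measurable_fun setT (fun t => y * \1_(f @^-1` [set y]) t).
  by apply: measurable_funM => //; exact: measurable_indic.
have mc0 : mcshane_integrable (fun=> 0).
  move=> e e0; exists (fun=> 1) => // x S _.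
  under eq_eseriesr => n _.
    under eq_integral do rewrite subrr normr0.
    rewrite integral0; over.
  by rewrite eseries0// lee_fin ltW.
elim: s => [|y s IH].
  by under eq_fun do rewrite big_nil.
under eq_fun do rewrite big_cons.
apply: mcshaneD => //; first exact: measurable_sum.
(* The zero level may have infinite measure, but its term vanishes; on every other level
   integrability forces finite measure. *)
have [->|y0] := eqVneq y 0.
  by under eq_fun do rewrite mul0r.
apply: mcshaneZ; first exact: measurable_indic.
apply: mcshane_indic_measurable => //.
have y0' : 0 < `|y| by rewrite normr_gt0.
have : (`|y|%:E * mu (f @^-1` [set y]) < +oo)%E.
  apply: le_lt_trans foo.
  rewrite -[X in (_ * mu X)%E]setIT -integral_indic// -ge0_integralZl//.
  - apply: ge0_le_integral => //.
    + apply: measurable_funeM.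
      by apply/measurable_EFinP; exact: measurable_indic.
    + by apply/measurable_EFinP; apply: measurableT_comp.
    + move=> t _; rewrite -EFinM lee_fin indicE.
      have [fty|ft] := pselect (f t = y).
        by rewrite mem_set// mulr1 /= fty.
      by rewrite memNset// mulr0.
  - by apply/measurable_EFinP; exact: measurable_indic.
apply: contraTT; rewrite -!leNgt !leye_eq => /eqP ->.
by rewrite gt0_muley.
Qed.

Theorem integrable_mcshane (f : T -> R) : mu.-integrable setT (EFin \o f) ->
  mcshane_integrable f.
Proof.
move=> If; have /integrableP[/measurable_EFinP mf _] := If.
apply: mcshane_closed => // e e0.
have [g [Ig _ /fine_cvgP[gfin gcvg]]] :=
  approximation_sfun_integrable measurableT If.
have [N _ /(_ N (leqnn N))[/= Nfin Ne]] := filterI gfin (cvgr_lt _ gcvg _ e0).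
exists (g N); split => //; first exact: mcshane_sfun.
by rewrite -[leLHS]fineK// lee_fin ltW.
Qed.

End mcshane.

(** Bridge from extended-real bounds on deviations to limits of real series: the partial sums of
    [|u n|] increase and stay below [M]. *)
Lemma nneseries_bounded (R : realType) (u a : R^nat) (M : R) :
  (forall n, `|u n| <= a n) -> (\sum_(0 <= n <oo) (a n)%:E <= M%:E)%E ->
  cvgn (series u) /\ `|limn (series u)| <= M.
Proof.
move=> ua aM; have a0 n : 0 <= a n by exact: le_trans (ua n).
have uM n : [normed series u] n <= M.
  rewrite -lee_fin; apply: le_trans aM.
  apply: le_trans (nneseries_lim_ge n _); last by move=> k _ _; rewrite lee_fin.
  by rewrite /= sumEFin lee_fin ler_sum.
have cu : cvgn [normed series u].
  apply: nondecreasing_is_cvgn; last by exists M => _ [n _ <-].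
  by apply: nondecreasing_series => n _ _; exact: normr_ge0.
split; first exact: normed_cvg.
apply: le_trans (lim_series_norm cu) _.
by apply: limr_le => //; exact: nearW.
Qed.

(** * Sums over tagged families *)

Section tagged_sums.
Context d (T : measurableType d) (R : realType).
Variables (mu : {measure set T -> \bar R}).

(** Only points with [g y != 0] matter: [g] will be an extension by zero, and the sets of a packing
    cover almost all of [Omega], not of the space. *)
Lemma integral_ae_cover (D : set T) (g : T -> \bar R) :
  measurable D -> measurable_fun setT g ->
  mu.-negligible [set y | g y != 0 /\ ~ D y]%E ->
  (\int[mu]_(y in D) g y = \int[mu]_y g y)%E.
Proof.
move=> mD mg ng; rewrite integral_mkcond; apply: ae_eq_integral => //.
  apply/(measurable_restrictT _ mD).1; exact: measurable_funTS.
apply: negligibleS ng => y /=; apply: contra_notP => /not_andP h _.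
rewrite /patch; case: ifPn => // /negP; rewrite inE => nDy.
by case: h => [/negP/negPn/eqP|].
Qed.

Variables (x : nat -> T) (S : nat -> set T).
Hypothesis mS : forall n, measurable (S n).
Hypothesis tS : trivIset setT S.

Variable f : T -> R.
Hypothesis If : mu.-integrable setT (EFin \o f).

Let mf : measurable_fun setT f.
Proof. by have /integrableP[/measurable_EFinP] := If. Qed.

Let dev := (\sum_(0 <= n <oo) \int[mu]_(y in S n) `|f (x n) - f y|%:E)%E.

(** Integrate [|f (x n)| <= |f (x n) - f y| + |f y|] over the disjoint sets [S n]. *)
Lemma nneseries_tags_le :
  (\sum_(0 <= n <oo) `|f (x n)|%:E * mu (S n) <=
    dev + \int[mu]_y `|f y|%:E)%E.
Proof.
have mnf : measurable_fun setT (fun y => `|f y|) by exact: measurableT_comp.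
have -> : (\sum_(0 <= n <oo) `|f (x n)|%:E * mu (S n) =
    \sum_(0 <= n <oo) \int[mu]_(y in S n) `|f (x n)|%:E)%E.
  by apply: eq_eseriesr => n _; rewrite integral_cst.
apply: le_trans (nneseries_integralD mu
  (v := fun n y => `|f (x n) - f y|) (w := fun=> fun y => `|f y|)
  mS _ _ _ _ _ _ _) _ => //.
- by move=> n; apply: measurableT_comp => //; exact: measurable_funB.
- by move=> n y _; rewrite -{1}[f (x n)](subrK (f y)) ler_normD.
apply: leeD2l; rewrite -ge0_integral_bigcup//.
- apply: ge0_subset_integral => //; first exact: bigcupT_measurable.
  exact/measurable_EFinP.
- exact/measurable_EFinP/measurable_funTS.
Qed.

Hypothesis covS : mu.-negligible [set y | f y != 0 /\ ~ (\bigcup_n S n) y].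

Let mD : measurable (\bigcup_n S n).
Proof. exact: bigcupT_measurable. Qed.

(** The same triangle inequality with the roles of [f y] and [f (x n)] exchanged; by [covS] the sets
    [S n] carry the whole integral of [|f|]. *)
Lemma integral_le_nneseries_tags :
  (\int[mu]_y `|f y|%:E <=
   \sum_(0 <= n <oo) `|f (x n)|%:E * mu (S n) + dev)%E.
Proof.
have mnf : measurable_fun setT (fun y => `|f y|) by exact: measurableT_comp.
rewrite -(@integral_ae_cover (\bigcup_n S n))//; last 2 first.
- exact/measurable_EFinP.
- apply: negligibleS covS => y /= [fy nS]; split => //.
  by apply: contra_neq fy => ->; rewrite normr0.
rewrite ge0_integral_bigcup//; last exact/measurable_EFinP/measurable_funTS.
have -> : (\sum_(0 <= n <oo) `|f (x n)|%:E * mu (S n) =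
    \sum_(0 <= n <oo) \int[mu]_(y in S n) `|f (x n)|%:E)%E.
  by apply: eq_eseriesr => n _; rewrite integral_cst.
apply: (nneseries_integralD mu (u := fun=> fun y => `|f y|)
  (v := fun n _ => `|f (x n)|) (w := fun n y => `|f (x n) - f y|)) => //.
- by move=> n; apply: measurableT_comp => //; exact: measurable_funB.
- by move=> n y _; rewrite -{1}[f y](subKr (f (x n))) ler_normB.
Qed.

Lemma series_tags_near (e : R) : (dev <= e%:E)%E ->
  cvgn [series f (x n) * fine (mu (S n))]_n /\
  `|limn [series f (x n) * fine (mu (S n))]_n - \int[mu]_y f y| <= e.
Proof.
move=> deve.
have IS n : mu.-integrable (S n) (EFin \o f) by exact: integrableS If.
have mdev n : measurable_fun (S n) (fun y => `|f (x n) - f y|).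
  by apply/measurable_funTS/measurableT_comp => //; exact: measurable_funB.
have dev0 n : (0 <= \int[mu]_(y in S n) `|f (x n) - f y|%:E)%E.
  exact: integral_ge0.
have devoo n : (\int[mu]_(y in S n) `|f (x n) - f y|%:E < +oo)%E.
  apply: le_lt_trans (le_lt_trans deve (ltry e)).
  by rewrite /dev (nneseriesD1 (n := n))// leeDl// nneseries_ge0.
have Idev n : mu.-integrable (S n) (EFin \o (fun y => f (x n) - f y)).
  apply/integrableP; split=> //.
  by apply/measurable_EFinP/measurable_funTS; exact: measurable_funB.
(* If [mu (S n)] is infinite, this says [f (x n) = 0], so that the junk value
   [fine +oo = 0] does no harm. *)
have Icst n : mu.-integrable (S n) (EFin \o cst (f (x n))).
  apply: eq_integrable (integrableD _ (Idev n) (IS n)) => //.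
  by move=> y _ /=; rewrite -EFinD subrK.
(* The comparison goes through these integrals: their differences from the Riemann terms are
   dominated by the deviations, and they sum to the integral of [f] by countable additivity. *)
pose v n := \int[mu]_(y in S n) f y.
have [c1 l1] : cvgn (series (fun n => f (x n) * fine (mu (S n)) - v n)) /\
    `|limn (series (fun n => f (x n) * fine (mu (S n)) - v n))| <= e.
  apply: (@nneseries_bounded _ _
    (fun n => \int[mu]_(y in S n) `|f (x n) - f y|)).
    move=> n; rewrite -Rintegral_cst// -RintegralB//.
    exact: le_normr_Rintegral.
  under eq_eseriesr => n _ do rewrite /Rintegral fineK ?ge0_fin_numE//.
  exact: deve.
have [c2 l2] : cvgn (series v) /\ limn (series v) = \int[mu]_y f y.
  have cv : cvgn (series v).
    have := @nneseries_bounded _ v (fun n => \int[mu]_(y in S n) `|f y|)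
      (\int[mu]_y `|f y|).
    case=> // [n|].
      exact: le_normr_Rintegral.
    have fin_abs D : measurable D ->
        (\int[mu]_(y in D) `|f y|%:E)%E \is a fin_num.
      move=> mD'; rewrite ge0_fin_numE ?integral_ge0//.
      by have /integrableP[] := integrableS measurableT mD' (@subsetT _ D) If.
    under eq_eseriesr => n _ do rewrite /Rintegral fineK ?fin_abs//.
    rewrite /Rintegral fineK ?fin_abs// -ge0_integral_bigcup//.
      apply: ge0_subset_integral => //.
      by apply/measurable_EFinP; apply: measurableT_comp.
    by apply/measurable_EFinP/measurable_funTS; apply: measurableT_comp.
  split=> //; apply: EFin_inj; rewrite -EFin_lim//.
  rewrite /Rintegral fineK; last exact: integrable_fin_num.
  rewrite -(@integral_ae_cover (\bigcup_n S n))//; last exact/measurable_EFinP.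
  rewrite integral_bigcup//; last exact: integrableS If.
  apply/congr_lim/funext => n /=; rewrite -sumEFin.
  by apply: eq_bigr => i _; rewrite /v /Rintegral fineK// integrable_fin_num.
have -> : [series f (x n) * fine (mu (S n))]_n =
    series (fun n => f (x n) * fine (mu (S n)) - v n) + series v.
  rewrite -seriesD; congr series; apply/funext => n.
  by rewrite /GRing.add /= subrK.
split; first exact: is_cvgD.
by rewrite limD// l2 addrK.
Qed.

End tagged_sums.

(** * Integrability from bounds on partial integrals *)

Section semifinite.
Context d (T : measurableType d) (R : realType).
Variables (mu : {measure set T -> \bar R}).

(** On [E n] the values of [|F|] lie between [1 / (n + 1)] and [n + 1], so [F] is integrable over
    its measurable subsets of finite measure. The bound on these subsets excludes that [E n] has
    infinite measure; hence it holds on [E n] itself, and monotone convergence concludes. *)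
Lemma semifinite_integrable (F : T -> R) (B : R) :
  (forall A (c : R), measurable A -> mu A = +oo%E ->
     exists K, [/\ measurable K, K `<=` A, (c%:E < mu K)%E & (mu K < +oo)%E]) ->
  measurable_fun setT F ->
  (forall A, measurable A -> mu.-integrable A (EFin \o F) ->
     (\int[mu]_(y in A) `|F y|%:E <= B%:E)%E) ->
  mu.-integrable setT (EFin \o F).
Proof.
move=> sf mF FB; have mnF : measurable_fun setT (fun y => `|F y|).
  exact: measurableT_comp.
pose E n := (fun y => `|F y|) @^-1` `[n.+1%:R^-1, n.+1%:R]%classic.
have EP n y : E n y <-> n.+1%:R^-1 <= `|F y| <= n.+1%:R.
  by rewrite /E /= in_itv.
have mE n : measurable (E n) by rewrite -[E n]setTI; exact: mnF.
have intE n K : measurable K -> K `<=` E n -> (mu K < +oo)%E ->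
    mu.-integrable K (EFin \o F).
  move=> mK KE Koo; apply: measurable_bounded_integrable => //.
    exact: measurable_funTS.
  exists n.+1%:R; split => // s ns y Ky.
  by have /EP/andP[_ /le_trans] := KE y Ky; apply; exact: ltW.
have Eoo n : (mu (E n) < +oo)%E.
  (* The integral of [|F|] over [K] is at least [mu K / (n + 1)], so a measure above [(n + 1) * B]
     contradicts [FB]. *)
  rewrite ltey; apply/eqP => /(sf _ (n.+1%:R * B) (mE n))[K [mK KE cK Koo]].
  have := FB K mK (intE n K mK KE Koo).
  apply/negP; rewrite -ltNge.
  apply: (@lt_le_trans _ _ (n.+1%:R^-1%:E * mu K)%E).
    by rewrite -lte_pdivrMl// invrK -EFinM.
  rewrite -integral_cst//; apply: ge0_le_integral => //.
  - by move=> y _; rewrite lee_fin.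
  - exact/measurable_EFinP/measurable_funTS.
  - by move=> y /KE/EP/andP[h _]; rewrite lee_fin.
apply/integrableP; split; first exact/measurable_EFinP.
apply: (@le_lt_trans _ _ B%:E); last exact: ltry.
have := ge0_nondecreasing_set_cvg_integral
  (F := E) (f := fun y => `|F y|%R%:E) (mu := mu).
rewrite (@integral_ae_cover _ _ _ _ (\bigcup_n E n)); first last.
- rewrite [X in mu.-negligible X](_ : _ = set0); first exact: negligible_set0.
  apply/seteqP; split => // y /= [Fy nE]; apply: nE.
  have Fy0 : 0 < `|F y|.
    by rewrite normr_gt0; apply: contra_neq Fy => ->; rewrite normr0.
  (* The successor of this index exceeds the sum, hence both [|F y|] and its inverse. *)
  exists (Num.truncn (`|F y|^-1 + `|F y|)) => //; apply/EP.
  have h := truncnS_gt (`|F y|^-1 + `|F y|).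
  rewrite -[leRHS]invrK lef_pV2 ?posrE ?invr_gt0// ?ltr0n//.
  rewrite (le_trans _ (ltW h)) ?lerDl//= (le_trans _ (ltW h))//.
  by rewrite lerDr invr_ge0.
- exact/measurable_EFinP.
- exact: bigcupT_measurable.
move=> /(_ _ _ _ _)/cvge_to_le; apply => //.
- move=> m n mn; rewrite subsetEset => y /EP/andP[h1 h2]; apply/EP/andP; split.
    by apply: le_trans h1; rewrite lef_pV2 ?posrE ?ltr0n// ler_nat.
  by apply: (le_trans h2); rewrite ler_nat.
- by move=> n; exact/measurable_EFinP/measurable_funTS.
- by apply: nearW => n; apply: FB => //; exact: (intE n).
Qed.

End semifinite.

(** * Regularity of completed Radon measures *)

Section closed_balls.
Context (R : realType) (X : normedModType R) (M : set (set X)).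
Variable mu : {measure set (g_sigma_algebraType M) -> \bar R}.

(** The balls of [X] are retyped on [completionType mu], the measurable type to which the McShane
    criterion is applied. *)
Definition closed_balls :
    completionType mu -> R -> set (completionType mu) :=
  closed_ball_ (Num.norm : X -> R).

Lemma closed_ballsS (x : completionType mu) (r s : R) :
  r <= s -> closed_balls x r `<=` closed_balls x s.
Proof. by move=> rs y /= /le_trans; apply. Qed.

Lemma nbhd_of_open (A U : set X) : open U -> A `<=` U ->
  nbhd_of closed_balls A U.
Proof.
move=> oU AU x Ax; have /nbhs_closedballP[r rU] : nbhs x U.
  by apply: open_nbhs_nbhs; split => //; exact: AU.
by exists r%:num => //; rewrite /closed_balls -closed_ballE.
Qed.

End closed_balls.
Arguments closed_balls {R X M} mu x r.

Section radon.
Context (R : realType) (X : normedModType R) (M : set (set X)).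
Variable mu : {measure set (g_sigma_algebraType M) -> \bar R}.
Hypothesis mu_radon : radon_measure mu.


Lemma radon_measurableE : (measurable : set (set (g_sigma_algebraType M))) = M.
Proof.
by case: mu_radon => sM _ _ _ _; exact: measurable_g_measurableTypeE.
Qed.

Lemma radon_open (U : set X) : open U -> M U.
Proof.
by case: mu_radon => _ bM _ _ _ oU; apply: bM; exact: sub_sigma_algebra.
Qed.

Lemma radon_compact (K : set X) : compact K -> M K.
Proof.
move=> cK; rewrite -radon_measurableE -[K]setCK; apply: measurableC.
rewrite radon_measurableE; apply: radon_open; apply: closed_openC.
exact: compact_closed (@norm_hausdorff _ _) cK.
Qed.

Lemma completion_measurable (A : set X) : M A ->
  measurable (A : set (completionType mu)) /\ completion mu A = mu A.
Proof.
move=> MA; rewrite measurable_completionE.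
have mA : measurable (A : set (g_sigma_algebraType M)).
  by rewrite radon_measurableE.
have n0 := negligible_set0 mu.
by split; [exists A => //; exists set0 => //; exact: setU0
         | rewrite -[X in completion _ X]setU0 completionE].
Qed.

(** The negligible part [N] is enlarged to a null set [N'] of the original sigma-algebra, and outer
    regularity of [mu] is applied to the union of [B] and [N']. *)
Lemma completion_outer_regular (A : set (completionType mu)) (e : R) :
  measurable A -> (completion mu A < +oo)%E -> 0 < e ->
  exists G, [/\ measurable G, A `<=` G,
    (completion mu G <= completion mu A + e%:E)%E
    & nbhd_of (closed_balls mu) A G].
Proof.
move=> + + e0.
rewrite {1}measurable_completionE => -[B mB [N nN <-]].
rewrite completionE// => Boo; have [N' [mN' N'0 NN']] := nN.
have [_ _ _ _ out] := mu_radon.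
have MBN : M (B `|` N') by rewrite -radon_measurableE; exact: measurableU.
have muBN : (mu (B `|` N') <= mu B)%E.
  by have := measureU2 mu mB mN'; rewrite [X in (_ + X)%E](_ : _ = 0%E) ?adde0.
have : (mu (B `|` N') < mu B + e%:E)%E.
  apply: le_lt_trans muBN _; rewrite lteDl ?lte_fin//.
  by rewrite ge0_fin_numE.
rewrite (out _ MBN) => /ereal_inf_lt[_ [G [oG BNG] <-] Glt].
have [mG GE] := completion_measurable (radon_open oG).
have BNG' : B `|` N `<=` G by apply: subset_trans BNG; exact: setUS.
exists G; split => //; first by rewrite GE ltW.
exact: nbhd_of_open.
Qed.

(** Inner regularity is applied to the measurable kernel [B]. The threshold [c] also allows sets of
    infinite measure, as needed for [semifinite_integrable]. *)
Lemma completion_compact (A : set (completionType mu)) (c : R) :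
  measurable A -> (c%:E < completion mu A)%E ->
  exists K, [/\ measurable K, K `<=` A, (c%:E < completion mu K)%E,
    (completion mu K < +oo)%E
    & nbhd_of (closed_balls mu) (~` K) (~` K)].
Proof.
rewrite {1}measurable_completionE => -[B mB [N nN <-]].
rewrite completionE//; have [_ _ cfin inn _] := mu_radon.
have MB : M B by rewrite -radon_measurableE.
rewrite (inn _ MB) => /ereal_sup_gt[_ [K [cK KB] <-] cltK].
have [mK KE] := completion_measurable (radon_compact cK).
exists K; split; rewrite ?KE//.
- by apply: subset_trans KB _; exact: subsetUl.
- exact: cfin.
- apply: nbhd_of_open => //; apply: closed_openC.
  exact: compact_closed (@norm_hausdorff _ _) cK.
Qed.

Lemma completion_inner_regular (A : set (completionType mu)) (e : R) :
  measurable A -> (completion mu A < +oo)%E -> 0 < e ->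
  exists K, [/\ measurable K, K `<=` A,
    (completion mu A <= completion mu K + e%:E)%E
    & nbhd_of (closed_balls mu) (~` K) (~` K)].
Proof.
move=> mA Aoo e0.
have Afin : completion mu A \is a fin_num by rewrite ge0_fin_numE.
have [|K [mK KA cK _ oK]] :=
  @completion_compact A (fine (completion mu A) - e) mA.
  by rewrite EFinB fineK// lteBlDr// lteDl// lte_fin.
exists K; split => //; move: cK; rewrite EFinB fineK// lteBlDr//.
exact: ltW.
Qed.

End radon.

(** * Morse packings *)

(** Padding keeps the numbering, so tags and sets stay aligned; at the added indices the measure 0
    kills the value at the tag. *)
Definition padded T (I : set nat) (S : nat -> set T) (n : nat) : set T :=
  if n \in I then S n else set0.

Section morse.
Context (R : realType) (X : normedModType R) (M : set (set X)).
Variable mu : {measure set (g_sigma_algebraType M) -> \bar R}.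
Hypothesis mu_radon : radon_measure mu.
Variables (lambda : R) (Omega : set X) (C : set (X * set X)).
Hypothesis mOmega : measurable (Omega : set (completionType mu)).
Hypothesis aeC : ae_morse_cover mu lambda Omega C.

Local Notation m :=
  (completion mu : {measure set (completionType mu) -> \bar R}).

Lemma radon_mcshane (g : completionType mu -> R) :
  m.-integrable setT (EFin \o g) -> mcshane_integrable m (closed_balls mu) g.
Proof.
apply: integrable_mcshane.
- exact: closed_ballsS.
- exact: completion_outer_regular.
- exact: completion_inner_regular.
Qed.

Variables (delta : X -> R) (I : set nat) (x : nat -> X) (S : nat -> set X).
Hypothesis pS : fine_packing mu lambda Omega C delta I x S.

Let Sp : nat -> set (completionType mu) := padded I S.

(** Here Morse sets become McShane sets: fineness bounds the outer radius [lambda * r] by the gauge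
    at the tag. *)
Lemma padded_tagP n : I n ->
  [/\ Omega (x n), measurable (S n : set (completionType mu))
    & S n `<=` closed_balls mu (x n) (delta (x n))].
Proof.
move=> In; have [_ _ /(_ n In)[CS [r [[_ _ Sr _] rd]]] _] := pS.
have [[+ _ _] _ + _] := aeC => /(_ _ _ CS)[Ox _] /(_ _ _ CS) mS; split => //.
by apply: subset_trans Sr _; exact: closed_ballsS.
Qed.

Lemma measurable_padded n : measurable (Sp n).
Proof.
rewrite /Sp /padded; case: ifPn => [/set_mem|_]; last exact: measurable0.
by case/padded_tagP.
Qed.

Lemma trivIset_padded : trivIset setT Sp.
Proof.
have [_ tS _ _] := pS; move=> i j _ _ [y []]; rewrite /Sp /padded.
case: ifPn => // /set_mem Ii Si; case: ifPn => // /set_mem Ij Sj.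
by apply: tS => //; exists y.
Qed.

Lemma packing_padded (delta' : X -> R) :
  (forall t, Omega t -> delta t <= delta' t) ->
  packing (closed_balls mu) delta' x Sp.
Proof.
move=> dd; split; [exact: measurable_padded|exact: trivIset_padded|].
move=> n; rewrite /Sp /padded; case: ifPn => [/set_mem In|_];
  last exact: sub0set.
have [Ox _ Sx] := padded_tagP In; apply: subset_trans Sx _.
by apply: closed_ballsS; exact: dd.
Qed.

Variable f : X -> R.
Let F : completionType mu -> R := (f : completionType mu -> R) \_ Omega.

(** Stated for any [g] vanishing off [Omega], to serve both for [F] and for its restrictions to
    smaller sets. *)
Lemma padded_cover (g : completionType mu -> R) :
  (forall y, ~ Omega y -> g y = 0) ->
  m.-negligible [set y | g y != 0 /\ ~ (\bigcup_n Sp n) y].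
Proof.
move=> g0; have [_ _ _ O0] := pS.
have US : \bigcup_(n in I) S n = \bigcup_n Sp n.
  apply/seteqP; split => [y [n In Sy]|y [n _]].
    by exists n => //; rewrite /Sp /padded mem_set.
  by rewrite /Sp /padded; case: ifPn => // /set_mem In Sy; exists n.
exists (Omega `\` \bigcup_n Sp n); split.
- apply: measurableD => //; apply: bigcupT_measurable.
  exact: measurable_padded.
- by rewrite -US.
- move=> y [gy nS]; split => //; apply: contrapT => /g0 gy0.
  by rewrite gy0 eqxx in gy.
Qed.

(** Tags with index in [I] lie in [Omega], where [f] and its extension by zero agree. *)
Lemma tag_sumsE :
  (\sum_(0 <= n <oo | n \in I) (`|f (x n)|%:E * completion mu (S n)) =
   \sum_(0 <= n <oo) `|F (x n)|%:E * m (Sp n))%E.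
Proof.
rewrite eseries_mkcond; apply: eq_eseriesr => n _; rewrite /Sp /padded.
case: ifPn => [/set_mem In|_]; last by rewrite measure0 mule0.
by have [Ox _ _] := padded_tagP In; rewrite /F patchE mem_set.
Qed.

Lemma riemann_seriesE : riemann_series mu f I x S =
  [series F (x n) * fine (m (Sp n))]_n.
Proof.
congr series; apply/funext => n; rewrite /Sp /padded /=.
case: ifPn => [/set_mem In|_]; last by rewrite measure0 mulr0.
by have [Ox _ _] := padded_tagP In; rewrite /F patchE mem_set.
Qed.

End morse.

(** * Bounded sums, integrability and Riemann sums *)

Section corollary.
Context (R : realType) (X : normedModType R) (M : set (set X)).
Variable mu : {measure set (g_sigma_algebraType M) -> \bar R}.
Hypothesis mu_radon : radon_measure mu.
Variables (lambda : R) (Omega : set X) (C : set (X * set X)).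
Hypothesis mOmega : measurable (Omega : set (completionType mu)).
Hypothesis aeC : ae_morse_cover mu lambda Omega C.
Variable f : X -> R.
Local Notation m :=
  (completion mu : {measure set (completionType mu) -> \bar R}).
Let F : completionType mu -> R := (f : completionType mu -> R) \_ Omega.

(** The McShane criterion requires integrability, so it is applied to the restriction [g] of [F] to
    a set [A] where [F] is integrable. The tag sums of [g] are at most those of [f], hence at most
    [B], and the deviation adds at most 1. *)
Lemma bounded_sums_integrable :
  measurable_fun (Omega : set (completionType mu)) f ->
  bounded_sums mu lambda Omega C f ->
  m.-integrable Omega (EFin \o f).
Proof.
move=> mf [B [d1 [B0 ud1 hB]]].
apply/(integrable_mkcond _ mOmega); rewrite restrict_EFin -/F.
apply: (@semifinite_integrable _ _ _ _ _ (B + 1)).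
- move=> A c mA Aoo.
  have [|K [mK KA cK Koo _]] := completion_compact mu_radon (c := c) mA.
    by rewrite Aoo ltry.
  by exists K.
- by apply/(measurable_restrictT _ mOmega).
move=> A mA IA; pose g : completionType mu -> R := F \_ A.
have Ig : m.-integrable setT (EFin \o g).
  by rewrite /g -restrict_EFin; apply/(integrable_mkcond _ mA).1.
have [d2 d20 hd2] := radon_mcshane mu_radon Ig ltr01.
(* [d1] bounds the tag sums and [d2] the deviation of [g]; the covering property of [C] then
   supplies a packing fine for both. *)
pose delta t := Order.min (d1 t) (d2 t).
have [_ _ _ /(_ 1 delta ltr01)] := aeC.
case=> [|I [x [S [pS _]]]].
  split=> [a Oa|].
    by rewrite /delta lt_min d20 andbT; case/andP: (ud1 a Oa).
  by exists 1 => a Oa; rewrite /delta ge_min; case/andP: (ud1 a Oa) => _ ->.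
have pS1 : fine_packing mu lambda Omega C d1 I x S.
  have [sI tS hS cS] := pS; split => // n /hS[CS [r [mr rd]]]; split => //.
  by exists r; split => //; apply: le_trans rd _; rewrite ge_min lexx.
have pS2 : packing (closed_balls mu) d2 x (padded I S).
  apply: (packing_padded aeC pS) => t _.
  by rewrite /delta ge_min lexx orbT.
have [mS tS _] := pS2.
have -> : (\int[m]_(y in A) `|F y|%:E = \int[m]_y `|g y|%:E)%E.
  rewrite integral_mkcond; apply: eq_integral => y _.
  by rewrite /g !patchE; case: ifPn => //; rewrite normr0.
have := integral_le_nneseries_tags (x : nat -> completionType mu) mS tS Ig.
move/(_ _)/le_trans; apply.
  apply: (padded_cover mOmega aeC pS) => y nOy.
  by rewrite /g /F !patchE (memNset nOy) if_same.
rewrite EFinD; apply: leeD; last exact: hd2.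
apply: le_trans (hB _ _ _ pS1); rewrite (tag_sumsE aeC pS).
apply: lee_nneseries => [n _ _|n _]; first by rewrite mule_ge0.
apply: lee_wpmul2r => //; rewrite lee_fin /g patchE.
by case: ifPn => //; rewrite normr0.
Qed.

Lemma integrable_bounded_sums :
  m.-integrable Omega (EFin \o f) -> bounded_sums mu lambda Omega C f.
Proof.
move=> /(integrable_mkcond _ mOmega); rewrite restrict_EFin -/F => IF.
have [d1 d10 hd1] := radon_mcshane mu_radon IF ltr01.
have iF : (\int[m]_y `|F y|%:E)%E \is a fin_num.
  by rewrite ge0_fin_numE ?integral_ge0//; case/integrableP: IF.
(* The 1 is the deviation allowed by [d1]; the minimum with 1 makes the gauge a unit gauge. *)
exists (1 + fine (\int[m]_y `|F y|%:E)), (fun t => Order.min (d1 t) 1); split.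
- by rewrite addr_ge0// fine_ge0// integral_ge0.
- by move=> a _; rewrite lt_min d10 ltr01 ge_min lexx orbT.
move=> I x S pS.
have pS1 : packing (closed_balls mu) d1 x (padded I S).
  by apply: (packing_padded aeC pS) => t _; rewrite ge_min lexx.
have [mS tS _] := pS1.
rewrite (tag_sumsE aeC pS) EFinD fineK//.
apply: le_trans (nneseries_tags_le (x : nat -> completionType mu) mS tS IF) _.
by rewrite leeD2r// hd1.
Qed.

Lemma integrable_riemann_series (eps : R) :
  m.-integrable Omega (EFin \o f) -> 0 < eps ->
  exists2 delta : X -> R, unit_gauge Omega delta &
    forall I x S, fine_packing mu lambda Omega C delta I x S ->
      cvgn (riemann_series mu f I x S) /\
      `|limn (riemann_series mu f I x S) - \int[m]_(t in Omega) f t| < eps.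
Proof.
move=> /(integrable_mkcond _ mOmega); rewrite restrict_EFin -/F => IF e0.
(* The McShane bound is not strict; halving [eps] yields the strict inequality. *)
have e20 : 0 < eps / 2 by rewrite divr_gt0.
have [d1 d10 hd1] := radon_mcshane mu_radon IF e20.
exists (fun t => Order.min (d1 t) 1).
  by move=> a _; rewrite lt_min d10 ltr01 ge_min lexx orbT.
move=> I x S pS.
have pS1 : packing (closed_balls mu) d1 x (padded I S).
  by apply: (packing_padded aeC pS) => t _; rewrite ge_min lexx.
have [mS tS _] := pS1.
rewrite Rintegral_mkcond -/F (riemann_seriesE aeC pS).
have [|cF lF] := series_tags_near mS tS IF _ (hd1 _ _ pS1).
  apply: (padded_cover mOmega aeC pS) => y nOy.
  by rewrite /F patchE memNset.
split => //; apply: le_lt_trans lF _.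
by rewrite ltr_pdivrMr// ltr_pMr// ltr1n.
Qed.

End corollary.

Theorem corollary14 (R : realType) (X : normedModType R) (d : nat)
    (Xfin : Vector.axiom d X)
    (M : set (set X)) (mu : {measure set (g_sigma_algebraType M) -> \bar R})
    (mu_radon : radon_measure mu)
    (Omega : set X) (mOmega : measurable (Omega : set (completionType mu)))
    (f : X -> R)
    (mf : measurable_fun (Omega : set (completionType mu)) f) :
  ((exists2 lambda : R, 1 <= lambda &
      exists2 C : set (X * set X), ae_morse_cover mu lambda Omega C &
        bounded_sums mu lambda Omega C f) ->
    (completion mu).-integrable Omega (EFin \o f)) /\
  ((completion mu).-integrable Omega (EFin \o f) ->
    forall lambda : R, 1 <= lambda ->
    forall C : set (X * set X), ae_morse_cover mu lambda Omega C ->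
      bounded_sums mu lambda Omega C f /\
      forall eps : R, 0 < eps ->
      exists2 delta : X -> R, unit_gauge Omega delta &
        forall (I : set nat) (x : nat -> X) (S : nat -> set X),
          fine_packing mu lambda Omega C delta I x S ->
          cvgn (riemann_series mu f I x S) /\
          `|limn (riemann_series mu f I x S)
            - \int[completion mu : {measure set (completionType mu) -> \bar R}]_(t in Omega)
                f t| < eps).
Proof.
split=> [[lambda _ [C aeC bC]]|If lambda _ C aeC].
  exact: bounded_sums_integrable bC.
split; first exact: integrable_bounded_sums.
by move=> eps eps0; exact: integrable_riemann_series.
Qed.
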